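(* Let $n\ge0$. A complete metric space $M$ is a strong $\mathrm{FAP}(n)$-space if and only if every point $z\in M$ has a neighborhood (with the restricted metric) which is a strong $\mathrm{FAP}(n)$-space.
   Context: $\mathbb I=[0,1]$. A metric space $M$ has $\mathrm{FAP}(k)$ if for every $\epsilon>0$, $m\ge0$ and map $g\colon\mathbb I^m\times\mathbb I^k\to M$ there is $g'\colon\mathbb I^m\times\mathbb I^k\to M$ $\epsilon$-homotopic to $g$ (there is a homotopy $h$ from $g$ to $g'$ with $\operatorname{diam}h(\{x\}\times\mathbb I)<\epsilon$ for all $x$) with $\dim g'(\{z\}\times\mathbb I^k)\le k$ for all $z\in\mathbb I^m$. $M$ is a strong $\mathrm{FAP}(n)$-space if $M\in\mathrm{FAP}(k)$ for every $0\le k\le n$. *)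

(* Defs.v *)
From Stdlib Require Import Reals List Lia ProofIrrelevance.
Open Scope R_scope.

Record MetricSpace := {
  pt :> Type;
  dist : pt -> pt -> R;
  dist_nonneg : forall x y, 0 <= dist x y;
  dist_eq0 : forall x y, dist x y = 0 <-> x = y;
  dist_sym : forall x y, dist x y = dist y x;
  dist_tri : forall x y z, dist x z <= dist x y + dist y z
}.
Arguments dist {m} _ _.

Lemma sub_eq0 (M : MetricSpace) (U : M -> Prop) (x y : {x : M | U x}) :
  dist (proj1_sig x) (proj1_sig y) = 0 <-> x = y.
Proof.
  destruct x as [x hx], y as [y hy]; simpl; split.
  - intro H; apply dist_eq0 in H; subst y.
    rewrite (proof_irrelevance _ hx hy); reflexivity.
  - intro H; inversion H; apply dist_eq0; reflexivity.
Qed.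

Definition subspace (M : MetricSpace) (U : M -> Prop) : MetricSpace :=
  {| pt := {x : M | U x};
     dist := fun x y => dist (proj1_sig x) (proj1_sig y);
     dist_nonneg := fun x y => dist_nonneg M (proj1_sig x) (proj1_sig y);
     dist_eq0 := sub_eq0 M U;
     dist_sym := fun x y => dist_sym M (proj1_sig x) (proj1_sig y);
     dist_tri := fun x y z => dist_tri M (proj1_sig x) (proj1_sig y) (proj1_sig z) |}.

Definition complete (M : MetricSpace) : Prop :=
  forall u : nat -> M,
    (forall eps, eps > 0 -> exists N, forall p q, (p >= N)%nat -> (q >= N)%nat ->
        dist (u p) (u q) < eps) ->
    exists l : M, forall eps, eps > 0 -> exists N, forall p, (p >= N)%nat ->
        dist (u p) l < eps.

Definition is_neighborhood (M : MetricSpace) (z : M) (U : M -> Prop) : Prop :=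
  exists r, r > 0 /\ forall y, dist z y < r -> U y.

Definition cube (m : nat) : Type :=
  { x : nat -> R | forall i, ((i < m)%nat -> 0 <= x i <= 1) /\ ((i >= m)%nat -> x i = 0) }.
Definition unit_int : Type := { t : R | 0 <= t <= 1 }.

Definition cube_close (m : nat) (x y : cube m) (d : R) : Prop :=
  forall i, (i < m)%nat -> Rabs (proj1_sig x i - proj1_sig y i) < d.

Definition cont_map (M : MetricSpace) (m k : nat) (g : cube m * cube k -> M) : Prop :=
  forall x eps, eps > 0 -> exists delta, delta > 0 /\
    forall y, cube_close m (fst x) (fst y) delta -> cube_close k (snd x) (snd y) delta ->
      dist (g x) (g y) < eps.

Definition cont_htpy (M : MetricSpace) (m k : nat)
    (h : cube m * cube k -> unit_int -> M) : Prop :=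
  forall x t eps, eps > 0 -> exists delta, delta > 0 /\
    forall y s, cube_close m (fst x) (fst y) delta -> cube_close k (snd x) (snd y) delta ->
      Rabs (proj1_sig t - proj1_sig s) < delta ->
      dist (h x t) (h y s) < eps.

Definition eps_homotopic (M : MetricSpace) (m k : nat) (eps : R)
    (g g' : cube m * cube k -> M) : Prop :=
  exists h : cube m * cube k -> unit_int -> M,
    cont_htpy M m k h /\
    (forall x t, proj1_sig t = 0 -> h x t = g x) /\
    (forall x t, proj1_sig t = 1 -> h x t = g' x) /\
    (* diam h({x} x I) < eps, i.e. sup of distances is < eps *)
    (forall x, exists r, r < eps /\ forall s t, dist (h x s) (h x t) <= r).

Definition open_in (M : MetricSpace) (A U : M -> Prop) : Prop :=
  forall x, A x -> U x -> exists r, r > 0 /\ forall y, A y -> dist x y < r -> U y.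

Definition covering_dim_le (M : MetricSpace) (A : M -> Prop) (k : nat) : Prop :=
  forall Us : list (M -> Prop),
    (forall U, In U Us -> open_in M A U) ->
    (forall x, A x -> exists U, In U Us /\ U x) ->
    exists Vs : list (M -> Prop),
      (forall V, In V Vs -> open_in M A V) /\
      (forall x, A x -> exists V, In V Vs /\ V x) /\
      (forall V, In V Vs -> exists U, In U Us /\ forall x, A x -> V x -> U x) /\
      (forall x, A x -> forall l : list nat, NoDup l ->
         (forall i, In i l -> (i < length Vs)%nat /\ nth i Vs (fun _ => False) x) ->
         (length l <= k + 1)%nat).

Definition FAP (k : nat) (M : MetricSpace) : Prop :=
  forall (eps : R) (m : nat) (g : cube m * cube k -> M),
    eps > 0 -> cont_map M m k g ->
    exists g' : cube m * cube k -> M,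
      cont_map M m k g' /\ eps_homotopic M m k eps g g' /\
      forall z : cube m,
        covering_dim_le M (fun p => exists y : cube k, g' (z, y) = p) k.

Definition strong_FAP (n : nat) (M : MetricSpace) : Prop :=
  forall k, (k <= n)%nat -> FAP k M.

(* Main.v *)
(** A map into [M] is improved one small box of its domain at a time: the map sends
    the box into a good neighbourhood, FAP there provides a small homotopy, and a
    cutoff equal to 1 on a smaller box extends it by the constant homotopy.  Such a
    step may spoil what was gained on other boxes, but having fibre images with
    [eps]-fine covers of order at most [k + 1] on a box is an open condition.  So
    one visits every box infinitely often with [eps -> 0] and displacements small
    enough to preserve all earlier gains; completeness of [M] gives a limit
    homotopy, and the finite sum theorem for dimension assembles the boxes. *)

From Stdlib Require Import Arith Reals List Lia Lra ClassicalEpsilon.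
From Stdlib Require Import FunctionalExtensionality ProofIrrelevance.
From Coquelicot Require Import Rcomplements Compactness.
Require Import Defs.
Open Scope R_scope.

(** * Metric spaces *)

(** The obstacle is the collar of each box. There the cutoff stops the local homotopy before its
    end, at a stage about which FAP says nothing, so an exact dimension bound already reached on an
    overlapping box can be destroyed. Nor does a bound on the dimension of the image pass to uniform
    limits. What does survive is a cover at one scale, as long as all later displacements together
    are small against its Lebesgue number. A visit to a box therefore secures a single scale
    [(1 / 2) ^ n], and all scales together are reached only through infinitely many visits.

    The boxes live in the product of both cubes, because the bound is wanted on every fibre over
    [z]: a visit must give one Lebesgue number valid for all [z] in the box, and compactness of the
    parameter cube provides it.

    Step [n] is performed during the time from [1 - (1 / 2) ^ n] to [1 - (1 / 2) ^ S n]. All stages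
    are thus homotopies over the same unit interval, and their uniform limit is directly a homotopy
    starting at [g]. *)

Definition continuous (A B : MetricSpace) (f : A -> B) : Prop :=
  forall x eps, eps > 0 -> exists delta, delta > 0 /\
    forall y, dist x y < delta -> dist (f x) (f y) < eps.

Lemma dist_refl (A : MetricSpace) (x : A) : dist x x = 0.
Proof. now apply dist_eq0. Qed.

Lemma continuous_comp (A B C : MetricSpace) (f : A -> B) (g : B -> C) :
  continuous A B f -> continuous B C g -> continuous A C (fun x => g (f x)).
Proof.
  intros Hf Hg x eps He.
  destruct (Hg (f x) eps He) as [d [Hd H]].
  destruct (Hf x d Hd) as [d' [Hd' H']].
  exists d'; split; auto.
Qed.

Lemma continuous_lipschitz (A B : MetricSpace) (f : A -> B) (L : R) :
  (forall x y, dist (f x) (f y) <= L * dist x y) -> continuous A B f.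
Proof.
  intros H x eps He.
  pose proof (Rabs_pos L) as HL; pose proof (Rle_abs L) as HL'.
  exists (eps / (Rabs L + 1)); split.
  - apply Rdiv_lt_0_compat; lra.
  - intros y Hy; eapply Rle_lt_trans; [apply H|].
    pose proof (dist_nonneg A x y).
    apply Rle_lt_trans with ((Rabs L + 1) * dist x y); [nra|].
    apply Rlt_le_trans with ((Rabs L + 1) * (eps / (Rabs L + 1))).
    + apply Rmult_lt_compat_l; lra.
    + right; field; lra.
Qed.

Lemma R_dist_eq0 (x y : R) : Rabs (x - y) = 0 <-> x = y.
Proof. split; unfold Rabs; destruct Rcase_abs; lra. Qed.

Lemma R_dist_triangle (x y z : R) : Rabs (x - z) <= Rabs (x - y) + Rabs (y - z).
Proof. unfold Rabs; repeat destruct Rcase_abs; lra. Qed.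

Definition real_space : MetricSpace :=
  {| pt := R; dist := fun x y => Rabs (x - y);
     dist_nonneg := fun x y => Rabs_pos _;
     dist_eq0 := R_dist_eq0;
     dist_sym := Rabs_minus_sym;
     dist_tri := R_dist_triangle |}.

Lemma prod_dist_eq0 (A B : MetricSpace) (x y : A * B) :
  Rmax (dist (fst x) (fst y)) (dist (snd x) (snd y)) = 0 <-> x = y.
Proof.
  destruct x as [a b], y as [a' b']; simpl; split.
  - intro H.
    pose proof (Rmax_l (dist a a') (dist b b')); pose proof (Rmax_r (dist a a') (dist b b')).
    pose proof (dist_nonneg A a a'); pose proof (dist_nonneg B b b').
    f_equal; apply dist_eq0; lra.
  - intro H; inversion H; rewrite !dist_refl; apply Rmax_left; lra.
Qed.

Lemma prod_dist_triangle (A B : MetricSpace) (x y z : A * B) :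
  Rmax (dist (fst x) (fst z)) (dist (snd x) (snd z)) <=
  Rmax (dist (fst x) (fst y)) (dist (snd x) (snd y)) +
  Rmax (dist (fst y) (fst z)) (dist (snd y) (snd z)).
Proof.
  pose proof (dist_tri A (fst x) (fst y) (fst z)).
  pose proof (dist_tri B (snd x) (snd y) (snd z)).
  unfold Rmax; repeat destruct Rle_dec; lra.
Qed.

Lemma prod_dist_nonneg (A B : MetricSpace) (x y : A * B) :
  0 <= Rmax (dist (fst x) (fst y)) (dist (snd x) (snd y)).
Proof. eapply Rle_trans; [apply dist_nonneg | apply Rmax_l]. Qed.

Lemma prod_dist_sym (A B : MetricSpace) (x y : A * B) :
  Rmax (dist (fst x) (fst y)) (dist (snd x) (snd y)) =
  Rmax (dist (fst y) (fst x)) (dist (snd y) (snd x)).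
Proof. now rewrite (dist_sym A), (dist_sym B). Qed.

Definition prod_space (A B : MetricSpace) : MetricSpace :=
  {| pt := A * B;
     dist := fun x y => Rmax (dist (fst x) (fst y)) (dist (snd x) (snd y));
     dist_nonneg := prod_dist_nonneg A B;
     dist_eq0 := prod_dist_eq0 A B;
     dist_sym := prod_dist_sym A B;
     dist_tri := prod_dist_triangle A B |}.

Lemma continuous_pair (A B C : MetricSpace) (f : A -> B) (g : A -> C) :
  continuous A B f -> continuous A C g ->
  continuous A (prod_space B C) (fun x => (f x, g x)).
Proof.
  intros Hf Hg x eps He.
  destruct (Hf x eps He) as [d [Hd H]]; destruct (Hg x eps He) as [d' [Hd' H']].
  exists (Rmin d d'); split; [now apply Rmin_glb_lt|].
  intros y Hy; simpl; apply Rmax_lub_lt; [apply H | apply H'];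
    eapply Rlt_le_trans; try exact Hy; [apply Rmin_l | apply Rmin_r].
Qed.

Lemma continuous_fst (A B : MetricSpace) : continuous (prod_space A B) A fst.
Proof.
  apply (continuous_lipschitz _ _ _ 1); intros x y; simpl.
  rewrite Rmult_1_l; apply Rmax_l.
Qed.

Lemma continuous_snd (A B : MetricSpace) : continuous (prod_space A B) B snd.
Proof.
  apply (continuous_lipschitz _ _ _ 1); intros x y; simpl.
  rewrite Rmult_1_l; apply Rmax_r.
Qed.

(** Off the zero set of [phi] its sign is locally constant, so a single branch is in use near the
    point; on the zero set both branches take the same value. *)
Lemma continuous_glue (A B : MetricSpace) (phi : A -> R) (f g : A -> B) :
  continuous A real_space phi -> continuous A B f -> continuous A B g ->
  (forall x, phi x = 0 -> f x = g x) ->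
  continuous A B (fun x => if Rle_dec (phi x) 0 then f x else g x).
Proof.
  intros Hphi Hf Hg Hfg x eps He.
  destruct (Hf x eps He) as [d1 [Hd1 H1]].
  destruct (Hg x eps He) as [d2 [Hd2 H2]].
  destruct (Req_dec (phi x) 0) as [E|E].
  - exists (Rmin d1 d2); split; [now apply Rmin_glb_lt|].
    intros y Hy.
    destruct (Rle_dec (phi x) 0) as [_|n]; [|lra].
    destruct (Rle_dec (phi y) 0).
    + apply H1; eapply Rlt_le_trans; [exact Hy | apply Rmin_l].
    + rewrite (Hfg x E); apply H2; eapply Rlt_le_trans; [exact Hy | apply Rmin_r].
  - destruct (Hphi x (Rabs (phi x)) (Rabs_pos_lt _ E)) as [d3 [Hd3 H3]].
    exists (Rmin d3 (Rmin d1 d2)); split; [now repeat apply Rmin_glb_lt|].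
    intros y Hy.
    assert (Hy3 : dist x y < d3) by (eapply Rlt_le_trans; [exact Hy | apply Rmin_l]).
    assert (Hy' : dist x y < Rmin d1 d2)
      by (eapply Rlt_le_trans; [exact Hy | apply Rmin_r]).
    assert (Hy1 : dist x y < d1) by (eapply Rlt_le_trans; [exact Hy' | apply Rmin_l]).
    assert (Hy2 : dist x y < d2) by (eapply Rlt_le_trans; [exact Hy' | apply Rmin_r]).
    specialize (H3 y Hy3); simpl in H3.
    destruct (Rle_dec (phi x) 0), (Rle_dec (phi y) 0); auto;
      exfalso; revert H3; unfold Rabs; repeat destruct Rcase_abs; lra.
Qed.

Lemma continuous_uniform_limit (A B : MetricSpace) (u : nat -> A -> B) (f : A -> B) :
  (forall n, continuous A B (u n)) ->
  (forall eps, eps > 0 -> exists n, forall x, dist (u n x) (f x) < eps) ->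
  continuous A B f.
Proof.
  intros Hu Hlim x eps He.
  destruct (Hlim (eps / 3)) as [n Hn]; [lra|].
  destruct (Hu n x (eps / 3)) as [d [Hd H]]; [lra|].
  exists d; split; [exact Hd|]; intros y Hy.
  specialize (H y Hy); pose proof (Hn x); pose proof (Hn y).
  pose proof (dist_tri B (f x) (u n x) (f y)).
  pose proof (dist_tri B (u n x) (u n y) (f y)).
  rewrite (dist_sym B (f x) (u n x)) in *; lra.
Qed.

(** * Compactness *)

(** Gauge form of compactness: an open cover is given by a radius at each point. This is the shape
    in which compactness of the interval is available and in which [compact_uniform] consumes it. *)
Definition compact_space (A : MetricSpace) : Prop :=
  forall r : A -> R, (forall x, r x > 0) ->
    exists l : list A, forall x, exists a, In a l /\ dist a x < r a.

Lemma list_lower_bound (T : Type) (r : T -> R) (l : list T) :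
  (forall x, r x > 0) -> exists d, d > 0 /\ forall x, In x l -> d <= r x.
Proof.
  intro Hr; induction l as [|a l [d [Hd IH]]].
  - exists 1; split; [lra | intros x []].
  - exists (Rmin d (r a)); split; [apply Rmin_glb_lt; [exact Hd | apply Hr]|].
    intros x [->|Hx]; [apply Rmin_r|].
    eapply Rle_trans; [apply Rmin_l | auto].
Qed.

(** Tube lemma: the fibre over [a] needs finitely many balls, and their least radius is the radius
    of a tube around [a]. *)
Lemma compact_prod (A B : MetricSpace) :
  compact_space A -> compact_space B -> compact_space (prod_space A B).
Proof.
  intros HA HB r Hr.
  destruct (choice (fun a (l : list B) => forall y, exists b, In b l /\ dist b y < r (a, b)))
    as [L HL].
  { intro a; apply HB; intro b; apply Hr. }
  destruct (choice (fun a d => d > 0 /\ forall b, In b (L a) -> d <= r (a, b)))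
    as [ra Hra].
  { intro a; apply (list_lower_bound B (fun b => r (a, b))); intro b; apply Hr. }
  destruct (HA ra) as [l Hl]; [intro a; apply Hra|].
  exists (flat_map (fun a => map (fun b => (a, b)) (L a)) l).
  intros [x y].
  destruct (Hl x) as [a [Ha Hax]]; destruct (HL a y) as [b [Hb Hby]].
  exists (a, b); split.
  - apply in_flat_map; exists a; split; [exact Ha|].
    now apply in_map.
  - simpl; apply Rmax_lub_lt; [|exact Hby].
    eapply Rlt_le_trans; [exact Hax | now apply Hra].
Qed.

Lemma compact_image (A B : MetricSpace) (f : A -> B) :
  continuous A B f -> (forall y, exists x, f x = y) ->
  compact_space A -> compact_space B.
Proof.
  intros Hf Hsurj HA r Hr.
  destruct (choice (fun x d => d > 0 /\ forall y, dist x y < d -> dist (f x) (f y) < r (f x)))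
    as [s Hs].
  { intro x; apply Hf, Hr. }
  destruct (HA s) as [l Hl]; [intro x; apply Hs|].
  exists (map f l); intro y.
  destruct (Hsurj y) as [x <-]; destruct (Hl x) as [a [Ha Hax]].
  exists (f a); split; [now apply in_map | now apply Hs].
Qed.

(** The common pattern behind uniform continuity, Lebesgue numbers and uniformity in the parameter.
    A single [d] is both the radius of the ball and the scale in [Phi]; monotonicity allows taking a
    minimum of the two. *)
Lemma compact_uniform (A : MetricSpace) (Phi : A -> R -> Prop) :
  compact_space A ->
  (forall x d d', 0 < d' <= d -> Phi x d -> Phi x d') ->
  (forall x, exists d, d > 0 /\ forall y, dist x y < d -> Phi y d) ->
  exists d, d > 0 /\ forall x, Phi x d.
Proof.
  intros HA Hmono Hloc.
  destruct (choice _ Hloc) as [r Hr].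
  destruct (HA r) as [l Hl]; [intro x; apply Hr|].
  destruct (list_lower_bound _ r l) as [d [Hd Hdl]]; [intro x; apply Hr|].
  exists d; split; [exact Hd|]; intro x.
  destruct (Hl x) as [a [Ha Hax]].
  apply (Hmono x (r a)); [split; auto | now apply Hr].
Qed.

Lemma uniform_continuity (A B : MetricSpace) (f : A -> B) (eps : R) :
  compact_space A -> continuous A B f -> eps > 0 ->
  exists d, d > 0 /\ forall x y, dist x y < d -> dist (f x) (f y) < eps.
Proof.
  intros HA Hf He.
  destruct (compact_uniform A
    (fun x d => forall y, dist x y < d -> dist (f x) (f y) < eps) HA) as [d [Hd H]].
  - intros x d d' Hd H y Hy; apply H; lra.
  - intro x; destruct (Hf x (eps / 2)) as [d [Hd H]]; [lra|].
    exists (d / 2); split; [lra|]; intros y Hy z Hz.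
    pose proof (dist_tri A x y z).
    assert (H1 := H y ltac:(lra)); assert (H2 := H z ltac:(lra)).
    pose proof (dist_tri B (f y) (f x) (f z)).
    rewrite (dist_sym B (f y) (f x)) in *; lra.
  - exists d; auto.
Qed.

(** * Cubes *)

Definition clamp (t : R) : R := Rmax 0 (Rmin 1 t).

Lemma clamp_bounds (t : R) : 0 <= clamp t <= 1.
Proof. unfold clamp, Rmax, Rmin; repeat destruct Rle_dec; lra. Qed.

Lemma clamp_id (t : R) : 0 <= t <= 1 -> clamp t = t.
Proof. unfold clamp, Rmax, Rmin; repeat destruct Rle_dec; lra. Qed.

Lemma clamp_big (t : R) : 1 <= t -> clamp t = 1.
Proof. unfold clamp, Rmax, Rmin; repeat destruct Rle_dec; lra. Qed.

Lemma clamp_lipschitz (s t : R) : Rabs (clamp s - clamp t) <= Rabs (s - t).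
Proof.
  unfold clamp, Rmax, Rmin, Rabs; repeat destruct Rle_dec; repeat destruct Rcase_abs; lra.
Qed.

Lemma sig_eq (T : Type) (P : T -> Prop) (x y : {x : T | P x}) :
  proj1_sig x = proj1_sig y -> x = y.
Proof.
  destruct x as [x hx], y as [y hy]; simpl; intros <-.
  now rewrite (proof_irrelevance _ hx hy).
Qed.

Lemma unit_dist_eq0 (x y : unit_int) :
  Rabs (proj1_sig x - proj1_sig y) = 0 <-> x = y.
Proof.
  rewrite R_dist_eq0; split; [apply sig_eq | now intros ->].
Qed.

Definition unit_space : MetricSpace :=
  {| pt := unit_int; dist := fun x y => Rabs (proj1_sig x - proj1_sig y);
     dist_nonneg := fun x y => Rabs_pos _;
     dist_eq0 := unit_dist_eq0;
     dist_sym := fun x y => Rabs_minus_sym _ _;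
     dist_tri := fun x y z => R_dist_triangle _ _ _ |}.

Definition to_unit (t : R) : unit_int := exist _ (clamp t) (clamp_bounds t).

Lemma to_unit_id (t : R) : 0 <= t <= 1 -> proj1_sig (to_unit t) = t.
Proof. apply clamp_id. Qed.

Lemma continuous_to_unit : continuous real_space unit_space to_unit.
Proof.
  apply (continuous_lipschitz _ _ _ 1); intros x y; simpl.
  rewrite Rmult_1_l; apply clamp_lipschitz.
Qed.

Lemma compact_unit : compact_space unit_space.
Proof.
  intros r Hr; apply NNPP; intro Hno.
  (* [compactness_list] asks for a gauge on the whole line and concludes only up to double negation;
     clamping extends [r], and [NNPP] has prepared the goal. *)
  apply (compactness_list 1 (0, tt) (1, tt)
           (fun t => mkposreal (r (to_unit (fst t))) (Hr _))).
  intros [l Hl]; apply Hno; exists (map (fun t => to_unit (fst t)) l).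
  intro x; destruct (Hl (proj1_sig x, tt)) as [[t []] [Hin [Hb Hc]]].
  { simpl; split; [apply proj2_sig | exact I]. }
  simpl in Hb, Hc.
  exists (to_unit t); split.
  - now apply (in_map (fun t : Tn 1 R => to_unit (fst t))) in Hin.
  - simpl; rewrite clamp_id by tauto; rewrite Rabs_minus_sym; tauto.
Qed.

Fixpoint sup_dist (m : nat) (x y : nat -> R) : R :=
  match m with
  | O => 0
  | S m => Rmax (sup_dist m x y) (Rabs (x m - y m))
  end.

Lemma sup_dist_ge (m : nat) (x y : nat -> R) (i : nat) :
  (i < m)%nat -> Rabs (x i - y i) <= sup_dist m x y.
Proof.
  induction m as [|m IH]; intro Hi; [lia|]; simpl.
  destruct (Nat.eq_dec i m) as [->|Hne]; [apply Rmax_r|].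
  eapply Rle_trans; [apply IH; lia | apply Rmax_l].
Qed.

Lemma sup_dist_le (m : nat) (x y : nat -> R) (d : R) :
  0 <= d -> (forall i, (i < m)%nat -> Rabs (x i - y i) <= d) -> sup_dist m x y <= d.
Proof.
  intro Hd; induction m as [|m IH]; intro H; [exact Hd|]; simpl.
  apply Rmax_lub; [apply IH; intros; apply H; lia | apply H; lia].
Qed.

Lemma sup_dist_lt (m : nat) (x y : nat -> R) (d : R) :
  0 < d -> (forall i, (i < m)%nat -> Rabs (x i - y i) < d) -> sup_dist m x y < d.
Proof.
  intro Hd; induction m as [|m IH]; intro H; [exact Hd|]; simpl.
  apply Rmax_lub_lt; [apply IH; intros; apply H; lia | apply H; lia].
Qed.

Lemma sup_dist_nonneg (m : nat) (x y : nat -> R) : 0 <= sup_dist m x y.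
Proof.
  destruct m as [|m]; [apply Rle_refl|]; simpl.
  eapply Rle_trans; [apply Rabs_pos | apply Rmax_r].
Qed.

Lemma sup_dist_sym (m : nat) (x y : nat -> R) : sup_dist m x y = sup_dist m y x.
Proof. induction m as [|m IH]; simpl; [|rewrite IH, Rabs_minus_sym]; reflexivity. Qed.

Lemma sup_dist_triangle (m : nat) (x y z : nat -> R) :
  sup_dist m x z <= sup_dist m x y + sup_dist m y z.
Proof.
  apply sup_dist_le.
  - pose proof (sup_dist_nonneg m x y); pose proof (sup_dist_nonneg m y z); lra.
  - intros i Hi; pose proof (sup_dist_ge m x y i Hi); pose proof (sup_dist_ge m y z i Hi).
    pose proof (R_dist_triangle (x i) (y i) (z i)); lra.
Qed.

Lemma cube_ext (m : nat) (x y : cube m) :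
  (forall i, (i < m)%nat -> proj1_sig x i = proj1_sig y i) -> x = y.
Proof.
  intro H; apply sig_eq, functional_extensionality; intro i.
  destruct (lt_dec i m) as [Hi|Hi]; [auto|].
  destruct x as [x hx], y as [y hy]; simpl.
  rewrite (proj2 (hx i)), (proj2 (hy i)); auto; lia.
Qed.

Lemma cube_dist_eq0 (m : nat) (x y : cube m) :
  sup_dist m (proj1_sig x) (proj1_sig y) = 0 <-> x = y.
Proof.
  split.
  - intro H; apply cube_ext; intros i Hi; apply R_dist_eq0.
    pose proof (sup_dist_ge m (proj1_sig x) (proj1_sig y) i Hi).
    pose proof (Rabs_pos (proj1_sig x i - proj1_sig y i)); lra.
  - intros ->; apply Rle_antisym; [|apply sup_dist_nonneg].
    apply sup_dist_le; [lra|]; intros; right; now apply R_dist_eq0.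
Qed.

Definition cube_space (m : nat) : MetricSpace :=
  {| pt := cube m; dist := fun x y => sup_dist m (proj1_sig x) (proj1_sig y);
     dist_nonneg := fun x y => sup_dist_nonneg m _ _;
     dist_eq0 := cube_dist_eq0 m;
     dist_sym := fun x y => sup_dist_sym m _ _;
     dist_tri := fun x y z => sup_dist_triangle m _ _ _ |}.

Lemma cube_close_dist (m : nat) (x y : cube m) (d : R) :
  d > 0 -> cube_close m x y d <-> dist (m := cube_space m) x y < d.
Proof.
  intro Hd; split.
  - intro H; now apply sup_dist_lt.
  - intros H i Hi; eapply Rle_lt_trans; [now apply (sup_dist_ge m) | exact H].
Qed.

Lemma clamp_cube_in (m : nat) (u : nat -> R) (i : nat) :
  ((i < m)%nat -> 0 <= (if lt_dec i m then clamp (u i) else 0) <= 1) /\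
  ((i >= m)%nat -> (if lt_dec i m then clamp (u i) else 0) = 0).
Proof. destruct (lt_dec i m); split; intros; try lia; auto using clamp_bounds. Qed.

(** A retraction of all sequences onto the cube. Maps into a cube can then be given by coordinate
    formulas without range proofs, and Lipschitz bounds survive because clamping does not increase
    distances. *)
Definition to_cube (m : nat) (u : nat -> R) : cube m :=
  exist _ (fun i => if lt_dec i m then clamp (u i) else 0) (clamp_cube_in m u).

Lemma to_cube_coord (m : nat) (u : nat -> R) (i : nat) :
  (i < m)%nat -> proj1_sig (to_cube m u) i = clamp (u i).
Proof. intro Hi; simpl; destruct (lt_dec i m); [reflexivity | lia]. Qed.

Lemma to_cube_dist (m : nat) (u v : nat -> R) (d : R) :
  0 <= d -> (forall i, (i < m)%nat -> Rabs (u i - v i) <= d) ->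
  dist (m := cube_space m) (to_cube m u) (to_cube m v) <= d.
Proof.
  intros Hd H; apply sup_dist_le; [exact Hd|]; intros i Hi.
  rewrite !to_cube_coord by exact Hi.
  eapply Rle_trans; [apply clamp_lipschitz | auto].
Qed.

Lemma to_cube_proj (m : nat) (x : cube m) : to_cube m (proj1_sig x) = x.
Proof.
  apply cube_ext; intros i Hi; rewrite to_cube_coord by exact Hi.
  apply clamp_id; now apply (proj2_sig x).
Qed.

Lemma compact_cube (m : nat) : compact_space (cube_space m).
Proof.
  induction m as [|m IH].
  - intros r Hr; exists (to_cube 0 (fun _ => 0) :: nil); intro x.
    eexists; split; [now left | apply Hr].
  - apply (compact_image (prod_space (cube_space m) unit_space) (cube_space (S m))
      (fun p => to_cube (S m) (fun i => if lt_dec i m then proj1_sig (fst p) i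
                                        else proj1_sig (snd p)))).
    + apply (continuous_lipschitz _ _ _ 1); intros [x s] [y t]; rewrite Rmult_1_l.
      apply to_cube_dist; [apply (dist_nonneg (prod_space (cube_space m) unit_space))|].
      intros i Hi; simpl; destruct (lt_dec i m).
      * eapply Rle_trans; [now apply (sup_dist_ge m) | apply Rmax_l].
      * apply Rmax_r.
    + intro x; exists (to_cube m (proj1_sig x), to_unit (proj1_sig x m)).
      apply cube_ext; intros i Hi; rewrite to_cube_coord by exact Hi.
      assert (Hx : 0 <= proj1_sig x i <= 1) by now apply (proj2_sig x).
      simpl; destruct (lt_dec i m).
      * now rewrite !clamp_id by (rewrite ?clamp_id; exact Hx).
      * replace i with m in * by lia.
        now rewrite !clamp_id by (rewrite ?clamp_id; exact Hx).
    + now apply compact_prod, compact_unit.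
Qed.

Definition fibred_cube (m k : nat) : MetricSpace :=
  prod_space (cube_space m) (cube_space k).

Lemma cont_map_continuous (M : MetricSpace) (m k : nat) (g : cube m * cube k -> M) :
  cont_map M m k g <-> continuous (fibred_cube m k) M g.
Proof.
  split; intros H x eps He; destruct (H x eps He) as [d [Hd Hg]];
    exists d; (split; [exact Hd|]).
  - intros y Hy; apply Hg; apply cube_close_dist; auto;
      eapply Rle_lt_trans; try exact Hy; [apply Rmax_l | apply Rmax_r].
  - intros y H1 H2; apply Hg; apply Rmax_lub_lt; now apply cube_close_dist.
Qed.

Lemma cont_htpy_continuous (M : MetricSpace) (m k : nat)
    (h : cube m * cube k -> unit_int -> M) :
  cont_htpy M m k h <->
  continuous (prod_space (fibred_cube m k) unit_space) M (fun p => h (fst p) (snd p)).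
Proof.
  split.
  - intros H [x t] eps He; destruct (H x t eps He) as [d [Hd Hg]].
    exists d; split; [exact Hd|]; intros [y s] Hy.
    assert (Hy1 := Rle_lt_trans _ _ _ (Rmax_l _ _) Hy).
    assert (Hy2 := Rle_lt_trans _ _ _ (Rmax_r _ _) Hy).
    apply Hg; [| |exact Hy2]; apply cube_close_dist; auto.
    + exact (Rle_lt_trans _ _ _ (Rmax_l _ _) Hy1).
    + exact (Rle_lt_trans _ _ _ (Rmax_r _ _) Hy1).
  - intros H x t eps He; destruct (H (x, t) eps He) as [d [Hd Hg]].
    exists d; split; [exact Hd|]; intros y s H1 H2 H3.
    apply (Hg (y, s)); repeat apply Rmax_lub_lt; try apply cube_close_dist; auto.
Qed.

(** * Fine covers and covering dimension *)

(** The multiplicity clause of [covering_dim_le], for an indexed family on an arbitrary set. *)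
Definition order_le (Y : Type) (N : nat) (V : nat -> Y -> Prop) (k : nat) (y : Y) : Prop :=
  forall l : list nat, NoDup l ->
    (forall i, In i l -> (i < N)%nat /\ V i y) -> (length l <= k + 1)%nat.

(** Merging members of a family cannot raise its order: choosing a preimage under [e] sends distinct
    merged sets through [y] to distinct original sets through [y]. *)
Lemma order_le_group (Y : Type) (N n : nat) (V : nat -> Y -> Prop) (e : nat -> nat)
    (k : nat) (y : Y) :
  order_le Y N V k y ->
  order_le Y n (fun i y => exists j, (j < N)%nat /\ e j = i /\ V j y) k y.
Proof.
  intros H l Hl HV.
  destruct (choice (fun i j => In i l -> (j < N)%nat /\ e j = i /\ V j y)) as [s Hs].
  { intro i; destruct (classic (In i l)) as [Hi|Hi].
    - destruct (HV i Hi) as [_ [j Hj]]; exists j; auto.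
    - exists 0%nat; tauto. }
  rewrite <- (length_map s l); apply H.
  - apply (NoDup_map_inv e); rewrite map_map.
    rewrite (map_ext_in _ (fun i => i)), map_id; [exact Hl|].
    intros i Hi; now apply Hs.
  - intros j Hj; apply in_map_iff in Hj as [i [<- Hi]].
    destruct (Hs i Hi) as [H1 [_ H2]]; auto.
Qed.

(* A cover of [Q] by subsets of the domain whose images are small, with Lebesgue
   number [c] for the pseudometric pulled back along [f].  Keeping the sets in the
   domain makes the notion obviously stable under perturbations of [f]. *)
Definition fine_cover (Y : Type) (M : MetricSpace) (f : Y -> M) (Q : Y -> Prop)
    (k : nat) (eps c : R) : Prop :=
  exists (N : nat) (V : nat -> Y -> Prop),
    (forall i y y', Q y -> Q y' -> V i y -> V i y' -> dist (f y) (f y') <= eps) /\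
    (forall y, Q y -> exists i, (i < N)%nat /\
       forall y', Q y' -> dist (f y) (f y') < c -> V i y') /\
    (forall y, Q y -> order_le Y N V k y).

(** The sets are kept, so their order is untouched; distances between values change by at most
    [2 * d], which is charged once to the mesh and once to the Lebesgue number. *)
Lemma fine_cover_perturb (Y : Type) (M : MetricSpace) (f f' : Y -> M) (Q : Y -> Prop)
    (k : nat) (eps eps' c c' d : R) :
  fine_cover Y M f Q k eps c -> (forall y, Q y -> dist (f y) (f' y) <= d) ->
  eps + 2 * d <= eps' -> c' + 2 * d <= c -> fine_cover Y M f' Q k eps' c'.
Proof.
  intros [N [V [Hmesh [Hleb Hord]]]] Hd Heps Hc.
  exists N, V; split; [|split; [|exact Hord]].
  - intros i y y' Qy Qy' Hy Hy'.
    specialize (Hmesh i y y' Qy Qy' Hy Hy').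
    pose proof (Hd y Qy); pose proof (Hd y' Qy').
    pose proof (dist_tri M (f' y) (f y) (f' y')).
    pose proof (dist_tri M (f y) (f y') (f' y')).
    rewrite (dist_sym M (f' y) (f y)) in *; lra.
  - intros y Qy; destruct (Hleb y Qy) as [i [Hi H]].
    exists i; split; [exact Hi|]; intros y' Qy' Hy'; apply H; [exact Qy'|].
    pose proof (Hd y Qy); pose proof (Hd y' Qy').
    pose proof (dist_tri M (f y) (f' y) (f y')).
    pose proof (dist_tri M (f' y) (f' y') (f y')).
    rewrite (dist_sym M (f' y') (f y')) in *; lra.
Qed.

Lemma fine_cover_mono (Y : Type) (M : MetricSpace) (f : Y -> M) (Q : Y -> Prop)
    (k : nat) (eps eps' c c' : R) :
  fine_cover Y M f Q k eps c -> eps <= eps' -> c' <= c ->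
  fine_cover Y M f Q k eps' c'.
Proof.
  intros H He Hc; apply (fine_cover_perturb Y M f f Q k eps eps' c c' 0 H);
    [intros; rewrite dist_refl| |]; lra.
Qed.

Lemma fine_cover_precomp (Y Z : Type) (M M' : MetricSpace) (f : Y -> M) (f' : Z -> M')
    (s : Z -> Y) (P : Y -> Prop) (Q : Z -> Prop) (k : nat) (eps c : R) :
  fine_cover Y M f P k eps c -> (forall z, Q z -> P (s z)) ->
  (forall z z', Q z -> Q z' -> dist (f' z) (f' z') = dist (f (s z)) (f (s z'))) ->
  fine_cover Z M' f' Q k eps c.
Proof.
  intros [N [V [Hmesh [Hleb Hord]]]] HPQ Hf.
  exists N, (fun i z => V i (s z)); split; [|split].
  - intros i z z' Qz Qz' Hz Hz'; rewrite Hf by assumption; eauto.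
  - intros z Qz; destruct (Hleb (s z) (HPQ z Qz)) as [i [Hi H]].
    exists i; split; [exact Hi|]; intros z' Qz' Hz'; apply H; [auto|].
    now rewrite <- Hf.
  - intros z Qz l Hl HV; now apply (Hord (s z) (HPQ z Qz)).
Qed.

Lemma lebesgue_number (B M : MetricSpace) (f : B -> M) (Us : list (M -> Prop)) :
  compact_space B -> continuous B M f ->
  (forall U, In U Us -> open_in M (fun p => exists y, f y = p) U) ->
  (forall y, exists U, In U Us /\ U (f y)) ->
  exists c, c > 0 /\ forall y, exists i, (i < length Us)%nat /\
    forall y', dist (f y) (f y') < c -> nth i Us (fun _ => False) (f y').
Proof.
  intros HB Hf Hopen Hcov.
  destruct (compact_uniform B (fun y c => exists i, (i < length Us)%nat /\
    forall y', dist (f y) (f y') < c -> nth i Us (fun _ => False) (f y')) HB)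
    as [c Hc].
  - intros y d d' Hd [i [Hi H]]; exists i; split; [exact Hi|].
    intros y' Hy'; apply H; lra.
  - intro y; destruct (Hcov y) as [U [HU Uy]].
    destruct (Hopen U HU (f y)) as [r [Hr H]]; [eauto | exact Uy |].
    destruct (Hf y (r / 2)) as [d [Hd Hfd]]; [lra|].
    destruct (In_nth Us U (fun _ => False) HU) as [i [Hi HiU]].
    exists (Rmin d (r / 2)); split; [apply Rmin_glb_lt; lra|].
    intros y1 Hy1; exists i; split; [exact Hi|]; intros y2 Hy2.
    rewrite HiU; apply H; [eauto|].
    pose proof (Rmin_l d (r / 2)); pose proof (Rmin_r d (r / 2)).
    specialize (Hfd y1 ltac:(lra)).
    pose proof (dist_tri M (f y) (f y1) (f y2)); lra.
  - exists c; exact Hc.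
Qed.

Lemma covering_dim_fine_cover (B M : MetricSpace) (f : B -> M) (k : nat) (eps : R) :
  compact_space B -> continuous B M f ->
  covering_dim_le M (fun p => exists y, f y = p) k -> eps > 0 ->
  exists c, c > 0 /\ fine_cover B M f (fun _ => True) k eps c.
Proof.
  intros HB Hf Hdim He.
  destruct (choice (fun x d => d > 0 /\
    forall y, dist x y < d -> dist (f x) (f y) < eps / 2)) as [r Hr].
  { intro x; apply Hf; lra. }
  destruct (HB r) as [l Hl]; [intro x; apply Hr|].
  (* The balls have radius [eps / 2], so any refinement has mesh at most [eps]. *)
  destruct (Hdim (map (fun a p => dist (f a) p < eps / 2) l)) as [Vs [Hopen [Hcov [Href Hord]]]].
  - intros U HU; apply in_map_iff in HU as [a [<- _]]; intros p _ Hp.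
    exists (eps / 2 - dist (f a) p); split; [lra|]; intros q _ Hq.
    pose proof (dist_tri M (f a) p q); lra.
  - intros p [y <-]; destruct (Hl y) as [a [Ha Hay]].
    exists (fun p => dist (f a) p < eps / 2); split; [|now apply Hr].
    now apply (in_map (fun a p => dist (f a) p < eps / 2)).
  - destruct (lebesgue_number B M f Vs HB Hf Hopen) as [c [Hc Hleb]].
    { intro y; apply Hcov; eauto. }
    exists c; split; [exact Hc|].
    exists (length Vs), (fun i y => (i < length Vs)%nat /\ nth i Vs (fun _ => False) (f y)).
    split; [|split].
    + intros i y y' _ _ [Hi Hy] [_ Hy'].
      destruct (Href _ (nth_In Vs (fun _ => False) Hi)) as [U [HU HVU]].
      apply in_map_iff in HU as [a [<- _]].
      pose proof (HVU (f y) ltac:(eauto) Hy) as H1.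
      pose proof (HVU (f y') ltac:(eauto) Hy') as H2; simpl in H1, H2.
      pose proof (dist_tri M (f y) (f a) (f y')).
      rewrite (dist_sym M (f y) (f a)) in *; lra.
    + intros y _; destruct (Hleb y) as [i [Hi H]].
      exists i; split; [exact Hi|]; auto.
    + intros y _ l' Hl' H; apply (Hord (f y)); [eauto | exact Hl' |].
      intros i Hi; now apply H.
Qed.

(** A cover of one fibre still serves the nearby fibres by [fine_cover_perturb], and compactness of
    [A] turns this into a common Lebesgue number. *)
Lemma fine_cover_uniform (A B M : MetricSpace) (f : A * B -> M) (k : nat) (eps : R) :
  compact_space A -> compact_space B -> continuous (prod_space A B) M f ->
  (forall z, covering_dim_le M (fun p => exists y, f (z, y) = p) k) -> eps > 0 ->
  exists c, c > 0 /\ forall z, fine_cover B M (fun y => f (z, y)) (fun _ => True) k eps c.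
Proof.
  intros HA HB Hf Hdim He.
  destruct (compact_uniform A
    (fun z c => fine_cover B M (fun y => f (z, y)) (fun _ => True) k eps c) HA) as [c Hc].
  - intros z d d' Hd H; apply (fine_cover_mono _ _ _ _ _ _ _ _ _ H); lra.
  - intro z.
    destruct (covering_dim_fine_cover B M (fun y => f (z, y)) k (eps / 2)) as [c [Hc H]];
      [exact HB | | apply Hdim | lra |].
    { apply (continuous_comp B (prod_space A B) M (fun y => (z, y))); [|exact Hf].
      apply (continuous_lipschitz _ _ _ 1); intros y y'; simpl.
      rewrite dist_refl, Rmax_right, Rmult_1_l; [apply Rle_refl | apply dist_nonneg]. }
    (* Moving values by at most [eps / 4] and [c / 4] raises the mesh from [eps / 2] to at most
       [eps] and leaves a Lebesgue number of at least [c / 2]. *)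
    pose proof (Rmin_l (eps / 4) (c / 4)); pose proof (Rmin_r (eps / 4) (c / 4)).
    destruct (uniform_continuity (prod_space A B) M f (Rmin (eps / 4) (c / 4)))
      as [d [Hd Hfd]]; [now apply compact_prod | exact Hf | apply Rmin_glb_lt; lra |].
    pose proof (Rmin_l d (c / 2)); pose proof (Rmin_r d (c / 2)).
    exists (Rmin d (c / 2)); split; [apply Rmin_glb_lt; lra|].
    intros z' Hz'; apply (fine_cover_perturb _ _ _ (fun y => f (z', y)) _ _ _ eps _
      (Rmin d (c / 2)) (Rmin (eps / 4) (c / 4)) H); [|lra|lra].
    intros y _; apply Rlt_le, Hfd; simpl.
    rewrite dist_refl; apply Rmax_lub_lt; lra.
  - exists c; exact Hc.
Qed.

(* Finite sum theorem: the cover is replaced, inside one [Q] after the other, by a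
   shrinking of order at most [k + 1]; outside [Q] nothing is removed. *)
Lemma shrink_cover (Y : Type) (M : MetricSpace) (f : Y -> M) (k n : nat)
    (L : list (Y -> Prop)) (U : nat -> Y -> Prop) (c : R) :
  (forall Q, In Q L -> forall eps, eps > 0 ->
     exists c, c > 0 /\ fine_cover Y M f Q k eps c) ->
  c > 0 ->
  (forall y, exists i, (i < n)%nat /\ forall y', dist (f y) (f y') < c -> U i y') ->
  exists W : nat -> Y -> Prop,
    (forall i y, W i y -> U i y) /\
    (forall Q y, In Q L -> Q y -> order_le Y n W k y) /\
    exists c', c' > 0 /\ forall y, exists i, (i < n)%nat /\
      forall y', dist (f y) (f y') < c' -> W i y'.
Proof.
  intros HL Hc HU; induction L as [|Q L IH].
  - exists U; split; [auto|]; split; [intros Q y []|]; exists c; auto.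
  - destruct IH as [W [HWU [HWord [c1 [Hc1 HW]]]]].
    { intros; apply HL; [now right | assumption]. }
    destruct (HL Q (or_introl eq_refl) (c1 / 2)) as [c0 [Hc0 Hfine]]; [lra|].
    set (c2 := Rmin c0 (c1 / 2)).
    assert (Hc2 : c2 > 0) by (apply Rmin_glb_lt; lra).
    assert (Hc21 : c2 <= c1 / 2) by apply Rmin_r.
    apply (fine_cover_mono _ _ _ _ _ _ (c1 / 2) _ c2) in Hfine; [|lra|apply Rmin_l].
    destruct Hfine as [N [V [Hmesh [Hleb Hord]]]].
    (* [e j] indexes a member of [W] containing [V j], with room to spare. *)
    destruct (choice (fun j i => forall q, Q q -> V j q ->
      (i < n)%nat /\ forall y, dist (f q) (f y) < c1 / 2 -> W i y)) as [e He].
    { intro j; destruct (classic (exists q, Q q /\ V j q)) as [[q [Qq Vq]]|Hno].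
      - destruct (HW q) as [i [Hi H]]; exists i; intros q' Qq' Vq'; split; [exact Hi|].
        intros y Hy; apply H.
        pose proof (Hmesh j q q' Qq Qq' Vq Vq').
        pose proof (dist_tri M (f q) (f q') (f y)); lra.
      - exists 0%nat; intros q Qq Vq; exfalso; eauto. }
    exists (fun i y => W i y /\ (Q y -> exists j, (j < N)%nat /\ e j = i /\ V j y)).
    split; [|split].
    + intros i y [H _]; auto.
    + intros Q' y [<-|HQ'] Qy l Hl HV.
      * apply (order_le_group Y N n V e k y (Hord y Qy) l Hl).
        intros i Hi; split; [now apply HV | now apply HV].
      * apply (HWord Q' y HQ' Qy l Hl).
        intros i Hi; split; now apply HV.
    + exists (c2 / 2); split; [lra|]; intro y.
      (* If [y] is near [Q], the [c2 / 2]-ball of [y] lies in the [c2]-ball of [q], whose part in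
         [Q] lies in [V j]. Otherwise the ball of [y] misses [Q], where nothing was removed. The
         uniform Lebesgue number does the work of closedness in the classical sum theorem. *)
      destruct (classic (exists q, Q q /\ dist (f y) (f q) < c2 / 2)) as [[q [Qq Hq]]|Hno].
      * destruct (Hleb q Qq) as [j [Hj HVj]].
        assert (Vq : V j q) by (apply HVj; [exact Qq | rewrite dist_refl; lra]).
        destruct (He j q Qq Vq) as [Hi HWi].
        exists (e j); split; [exact Hi|]; intros y' Hy'.
        assert (dist (f q) (f y') < c2).
        { pose proof (dist_tri M (f q) (f y) (f y')).
          rewrite (dist_sym M (f q) (f y)) in *; lra. }
        split; [apply HWi; lra|]; intro Qy'; exists j; auto.
      * destruct (HW y) as [i [Hi H]]; exists i; split; [exact Hi|].
        intros y' Hy'; split; [apply H; lra|]; intro Qy'; exfalso; eauto.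
Qed.

(** The way back from scales to dimension: a given open cover of the image has a Lebesgue number,
    and [shrink_cover] then uses the fine covers of the finitely many pieces at scales below it. *)
Lemma fine_cover_covering_dim (B M : MetricSpace) (f : B -> M) (k : nat)
    (L : list (B -> Prop)) :
  compact_space B -> continuous B M f ->
  (forall y, exists Q, In Q L /\ Q y) ->
  (forall Q, In Q L -> forall eps, eps > 0 ->
     exists c, c > 0 /\ fine_cover B M f Q k eps c) ->
  covering_dim_le M (fun p => exists y, f y = p) k.
Proof.
  intros HB Hf HLcov HL Us Hopen Hcov.
  destruct (lebesgue_number B M f Us HB Hf Hopen) as [c [Hc Hleb]].
  { intro y; apply Hcov; eauto. }
  destruct (shrink_cover B M f k (length Us) L
    (fun i y => nth i Us (fun _ => False) (f y)) c HL Hc Hleb)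
    as [W [HWU [HWord [c' [Hc' HW]]]]].
  (* [W i] need not be a union of fibres of [f], so its image could have larger order. Its interior
     for the pulled-back pseudometric is such a union, since points with equal values are at
     distance 0. *)
  set (O := fun i p => exists y, f y = p /\
    exists r, r > 0 /\ forall y', dist (f y) (f y') < r -> W i y').
  exists (map O (seq 0 (length Us))); split; [|split; [|split]].
  - intros V HV; apply in_map_iff in HV as [i [<- _]].
    intros p _ [y [<- [r [Hr H]]]]; exists r; split; [exact Hr|].
    intros q [y' <-] Hy'; exists y'; split; [reflexivity|].
    exists (r - dist (f y) (f y')); split; [lra|]; intros y2 Hy2; apply H.
    pose proof (dist_tri M (f y) (f y') (f y2)); lra.
  - intros p [y <-]; destruct (HW y) as [i [Hi H]].
    exists (O i); split.
    + apply in_map, in_seq; lia.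
    + exists y; split; [reflexivity|]; exists c'; auto.
  - intros V HV; apply in_map_iff in HV as [i [<- Hi]]; apply in_seq in Hi.
    exists (nth i Us (fun _ => False)); split; [apply nth_In; lia|].
    intros p _ [y [<- [r [Hr H]]]]; apply HWU, H; rewrite dist_refl; exact Hr.
  - intros p [y <-] l Hl H; destruct (HLcov y) as [Q [HQ Qy]].
    apply (HWord Q y HQ Qy l Hl); intros i Hi.
    destruct (H i Hi) as [Hlt Hnth]; rewrite length_map, length_seq in Hlt.
    split; [exact Hlt|].
    rewrite (nth_indep _ _ (O 0%nat)) in Hnth by (rewrite length_map, length_seq; exact Hlt).
    rewrite map_nth, seq_nth in Hnth by exact Hlt.
    destruct Hnth as [y' [Hy' [r [Hr HWr]]]]; apply HWr.
    rewrite Hy', dist_refl; exact Hr.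
Qed.

(** * Modifying a map inside a box *)

(* [unzoom p rho] maps the box of radius [2 * rho] around [p] into the cube, and
   [zoom p rho] inverts it on that box.  Clamping makes both maps total. *)
Definition zoom (m : nat) (p : cube m) (rho : R) (u : cube m) : cube m :=
  to_cube m (fun i => proj1_sig p i + (2 * proj1_sig u i - 1) * (2 * rho)).

Definition unzoom (m : nat) (p : cube m) (rho : R) (z : cube m) : cube m :=
  to_cube m (fun i => (proj1_sig z i - proj1_sig p i) / (4 * rho) + 1 / 2).

Lemma continuous_zoom (m : nat) (p : cube m) (rho : R) :
  rho > 0 -> continuous (cube_space m) (cube_space m) (zoom m p rho).
Proof.
  intro Hrho; apply (continuous_lipschitz _ _ _ (4 * rho)); intros x y.
  pose proof (dist_nonneg (cube_space m) x y).
  apply to_cube_dist; [nra|]; intros i Hi.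
  pose proof (sup_dist_ge m (proj1_sig x) (proj1_sig y) i Hi) as H1.
  replace (_ - _) with (4 * rho * (proj1_sig x i - proj1_sig y i)) by ring.
  rewrite Rabs_mult, (Rabs_right (4 * rho)) by lra.
  apply Rmult_le_compat_l; [lra | exact H1].
Qed.

Lemma continuous_unzoom (m : nat) (p : cube m) (rho : R) :
  rho > 0 -> continuous (cube_space m) (cube_space m) (unzoom m p rho).
Proof.
  intro Hrho; apply (continuous_lipschitz _ _ _ (/ (4 * rho))); intros x y.
  assert (Hinv : 0 < / (4 * rho)) by (apply Rinv_0_lt_compat; lra).
  pose proof (dist_nonneg (cube_space m) x y).
  apply to_cube_dist; [nra|]; intros i Hi.
  pose proof (sup_dist_ge m (proj1_sig x) (proj1_sig y) i Hi) as H1.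
  replace (_ - _) with (/ (4 * rho) * (proj1_sig x i - proj1_sig y i))
    by (field; lra).
  rewrite Rabs_mult, (Rabs_right (/ (4 * rho))) by lra.
  apply Rmult_le_compat_l; [lra | exact H1].
Qed.

(** Clamping cannot push a point out of the box: [p] is fixed by the clamp, and the clamp does not
    increase distances. Hence zooming sends the whole cube to where [f] takes values in [U]. *)
Lemma zoom_near (m : nat) (p : cube m) (rho : R) (u : cube m) :
  rho > 0 -> dist (m := cube_space m) (zoom m p rho u) p <= 2 * rho.
Proof.
  intro Hrho; rewrite <- (to_cube_proj m p) at 2.
  apply to_cube_dist; [lra|]; intros i Hi.
  pose proof (proj1 (proj2_sig u i) Hi) as Hu; simpl in Hu.
  replace (_ - _) with ((2 * proj1_sig u i - 1) * (2 * rho)) by ring.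
  rewrite Rabs_mult, (Rabs_right (2 * rho)) by lra.
  assert (Rabs (2 * proj1_sig u i - 1) <= 1) by (apply Rabs_le; lra).
  nra.
Qed.

Lemma zoom_unzoom (m : nat) (p : cube m) (rho : R) (z : cube m) :
  rho > 0 -> dist (m := cube_space m) z p <= 2 * rho -> zoom m p rho (unzoom m p rho z) = z.
Proof.
  intros Hrho Hz; apply cube_ext; intros i Hi.
  unfold zoom; rewrite to_cube_coord by exact Hi.
  unfold unzoom; rewrite to_cube_coord by exact Hi.
  pose proof (Rle_trans _ _ _ (sup_dist_ge m _ _ i Hi) Hz) as H.
  apply Rabs_le_between in H.
  rewrite (clamp_id (_ / _ + _)).
  - rewrite clamp_id; [field; lra|].
    replace (_ + _) with (proj1_sig z i) by (field; lra).
    now apply (proj2_sig z).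
  - assert (E : (proj1_sig z i - proj1_sig p i) / (4 * rho) * (4 * rho) =
                proj1_sig z i - proj1_sig p i) by (field; lra).
    split; nra.
Qed.

(** FAP applies to [f] zoomed to the box of radius [2 * rho], but a cover is gained only on radius
    [rho]: in the collar between them the homotopy is stopped before time 1. The cover comes back
    along [unzoom], with one [c] for all [z]. *)
Lemma perturb_on_box (M : MetricSpace) (m k : nat) (U : M -> Prop)
    (f : cube m * cube k -> M) (p : cube m * cube k) (rho eta eps : R) :
  FAP k (subspace M U) -> continuous (fibred_cube m k) M f -> rho > 0 ->
  (forall x, dist (m := fibred_cube m k) x p <= 2 * rho -> U (f x)) ->
  eta > 0 -> eps > 0 ->
  exists H : cube m * cube k -> unit_int -> M,
    continuous (prod_space (fibred_cube m k) unit_space) M (fun q => H (fst q) (snd q)) /\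
    (forall x, H x (to_unit 0) = f x) /\
    (forall x t, dist (f x) (H x t) < eta) /\
    exists c, c > 0 /\ forall z, dist (m := cube_space m) z (fst p) <= rho ->
      fine_cover (cube k) M (fun y => H (z, y) (to_unit 1))
        (fun y => dist (m := cube_space k) y (snd p) <= rho) k eps c.
Proof.
  intros HFAP Hf Hrho HU Heta Heps.
  set (zm := fun u : cube m * cube k => (zoom m (fst p) rho (fst u), zoom k (snd p) rho (snd u))).
  set (uz := fun x : cube m * cube k =>
               (unzoom m (fst p) rho (fst x), unzoom k (snd p) rho (snd x))).
  assert (Hzm : continuous (fibred_cube m k) (fibred_cube m k) zm).
  { apply (continuous_pair (fibred_cube m k) (cube_space m) (cube_space k)
             (fun u => zoom m (fst p) rho (fst u)) (fun u => zoom k (snd p) rho (snd u))).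
    - exact (continuous_comp _ _ _ _ _ (continuous_fst _ _) (continuous_zoom m (fst p) rho Hrho)).
    - exact (continuous_comp _ _ _ _ _ (continuous_snd _ _) (continuous_zoom k (snd p) rho Hrho)). }
  assert (Huz : continuous (fibred_cube m k) (fibred_cube m k) uz).
  { apply (continuous_pair (fibred_cube m k) (cube_space m) (cube_space k)
             (fun u => unzoom m (fst p) rho (fst u)) (fun u => unzoom k (snd p) rho (snd u))).
    - exact (continuous_comp _ _ _ _ _ (continuous_fst _ _) (continuous_unzoom m (fst p) rho Hrho)).
    - exact (continuous_comp _ _ _ _ _ (continuous_snd _ _) (continuous_unzoom k (snd p) rho Hrho)). }
  assert (Hzu : forall x, dist (m := fibred_cube m k) x p <= 2 * rho -> zm (uz x) = x).
  { intros [x y] Hx; unfold zm, uz; simpl fst; simpl snd.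
    rewrite !zoom_unzoom; auto.
    - exact (Rle_trans _ _ _ (Rmax_r _ _) Hx).
    - exact (Rle_trans _ _ _ (Rmax_l _ _) Hx). }
  assert (HUz : forall u, U (f (zm u))).
  { intro u; apply HU; apply Rmax_lub; now apply zoom_near. }
  set (F := fun u => exist U (f (zm u)) (HUz u) : subspace M U).
  destruct (HFAP eta m F Heta) as [g' [Hg' [[h [Hh [Hh0 [Hh1 Hsmall]]]] Hdim]]].
  { apply cont_map_continuous.
    exact (continuous_comp (fibred_cube m k) (fibred_cube m k) M zm f Hzm Hf). }
  apply cont_map_continuous in Hg'; apply cont_htpy_continuous in Hh.
  set (D := fun x => dist (m := fibred_cube m k) x p).
  (* The cutoff acts on time: [2 - D x / rho] is at least 1 on the inner box, so the whole homotopy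
     is run there, and it is 0 at distance [2 * rho], where the homotopy still equals [f] and can be
     continued by it. *)
  set (lam := fun x (t : unit_int) => to_unit (Rmin (proj1_sig t) (2 - D x / rho))).
  assert (HDpos : forall x, 0 <= D x) by (intro x; apply dist_nonneg).
  assert (HD : forall x y, Rabs (D x - D y) <= dist (m := fibred_cube m k) x y).
  { intros x y; unfold D; apply Rabs_le.
    pose proof (dist_tri (fibred_cube m k) x y p).
    pose proof (dist_tri (fibred_cube m k) y x p).
    rewrite (dist_sym (fibred_cube m k) y x) in *; lra. }
  assert (Hin0 : forall x, D x <= 2 * rho -> proj1_sig (h (uz x) (to_unit 0)) = f x).
  { intros x Hx; rewrite Hh0 by (apply to_unit_id; lra); simpl; now rewrite Hzu. }
  exists (fun x t => if Rle_dec (D x - 2 * rho) 0 then proj1_sig (h (uz x) (lam x t)) else f x).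
  split; [|split; [|split]].
  - apply (continuous_glue (prod_space (fibred_cube m k) unit_space) M
      (fun q => D (fst q) - 2 * rho)
      (fun q => proj1_sig (h (uz (fst q)) (lam (fst q) (snd q)))) (fun q => f (fst q))).
    + apply (continuous_lipschitz _ _ _ 1); intros [x s] [y t]; simpl fst.
      eapply Rle_trans; [|rewrite Rmult_1_l; apply Rmax_l]; simpl fst.
      change (Rabs ((D x - 2 * rho) - (D y - 2 * rho)) <= dist (m := fibred_cube m k) x y).
      replace (_ - _ - (_ - _)) with (D x - D y) by ring; apply HD.
    + apply (continuous_comp _ (subspace M U) M
               (fun q : prod_space (fibred_cube m k) unit_space =>
                  h (uz (fst q)) (lam (fst q) (snd q))) (@proj1_sig _ _)).
      2: { apply (continuous_lipschitz _ _ _ 1); intros; rewrite Rmult_1_l; apply Rle_refl. }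
      apply (continuous_comp _ (prod_space (fibred_cube m k) unit_space) (subspace M U)
               (fun q : prod_space (fibred_cube m k) unit_space =>
                  (uz (fst q), lam (fst q) (snd q))) (fun q => h (fst q) (snd q))); [|exact Hh].
      apply (continuous_pair _ (fibred_cube m k) unit_space
               (fun q : prod_space (fibred_cube m k) unit_space => uz (fst q))
               (fun q => lam (fst q) (snd q))).
      * exact (continuous_comp _ _ _ _ _ (continuous_fst _ _) Huz).
      * apply (continuous_comp _ real_space unit_space
          (fun q : prod_space (fibred_cube m k) unit_space =>
             Rmin (proj1_sig (snd q)) (2 - D (fst q) / rho)) to_unit); [|apply continuous_to_unit].
        apply (continuous_lipschitz _ _ _ (1 + / rho)); intros [x s] [y t].
        assert (Hinv : 0 < / rho) by now apply Rinv_0_lt_compat.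
        change (Rabs (Rmin (proj1_sig s) (2 - D x / rho) - Rmin (proj1_sig t) (2 - D y / rho)) <=
          (1 + / rho) * Rmax (dist (m := fibred_cube m k) x y) (Rabs (proj1_sig s - proj1_sig t))).
        pose proof (Rmax_l (dist (m := fibred_cube m k) x y) (Rabs (proj1_sig s - proj1_sig t))).
        pose proof (Rmax_r (dist (m := fibred_cube m k) x y) (Rabs (proj1_sig s - proj1_sig t))) as H2.
        set (d := Rmax _ _) in *.
        assert (H1 : Rabs (D x / rho - D y / rho) <= / rho * d).
        { replace (D x / rho - D y / rho) with (/ rho * (D x - D y)) by (field; lra).
          rewrite Rabs_mult, (Rabs_right (/ rho)) by lra.
          apply Rmult_le_compat_l; [lra|]; eapply Rle_trans; [apply HD | lra]. }
        assert (0 <= / rho * d)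
          by (eapply Rle_trans; [apply Rabs_pos | exact H1]).
        pose proof (Rabs_pos (proj1_sig s - proj1_sig t)).
        apply Rabs_le_between in H1.
        apply Rabs_le_between in H2.
        rewrite Rmult_plus_distr_r, Rmult_1_l.
        apply Rabs_le; unfold Rmin; repeat destruct Rle_dec; lra.
    + exact (continuous_comp _ _ _ _ _ (continuous_fst _ _) Hf).
    + intros [x t] Hx; simpl fst in *; simpl snd.
      replace (lam x t) with (to_unit 0); [apply Hin0; lra|].
      unfold lam; f_equal.
      replace (2 - D x / rho) with 0.
      * symmetry; apply Rmin_right; apply (proj2_sig t).
      * replace (D x) with (2 * rho) by lra; field; lra.
  - intro x; destruct Rle_dec as [Hx|Hx]; [|reflexivity].
    replace (lam x (to_unit 0)) with (to_unit 0); [apply Hin0; lra|].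
    unfold lam; f_equal; rewrite to_unit_id by lra.
    symmetry; apply Rmin_left.
    assert (D x / rho * rho = D x) by (field; lra); nra.
  - intros x t; destruct Rle_dec as [Hx|Hx].
    + rewrite <- (Hin0 x) by lra.
      destruct (Hsmall (uz x)) as [r [Hr H]].
      eapply Rle_lt_trans; [apply (H (to_unit 0) (lam x t)) | exact Hr].
    + now rewrite dist_refl.
  - destruct (fine_cover_uniform (cube_space m) (cube_space k) (subspace M U) g' k eps
      (compact_cube m) (compact_cube k) Hg' Hdim Heps) as [c [Hc Hfine]].
    exists c; split; [exact Hc|]; intros z Hz.
    apply (fine_cover_precomp _ _ _ _ _ _ (unzoom k (snd p) rho) (fun _ => True) _ _ _ _
      (Hfine (unzoom m (fst p) rho z))); [auto|].
    assert (Hin1 : forall y, dist (m := cube_space k) y (snd p) <= rho ->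
      (if Rle_dec (D (z, y) - 2 * rho) 0
       then proj1_sig (h (uz (z, y)) (lam (z, y) (to_unit 1))) else f (z, y)) =
      proj1_sig (g' (unzoom m (fst p) rho z, unzoom k (snd p) rho y))).
    { intros y Hy.
      assert (HDz : D (z, y) <= rho) by (apply Rmax_lub; assumption).
      destruct Rle_dec as [_|n]; [|lra].
      rewrite Hh1; [reflexivity|].
      unfold lam; rewrite (to_unit_id 1) by lra; rewrite Rmin_left.
      - apply to_unit_id; lra.
      - assert (D (z, y) / rho * rho = D (z, y)) by (field; lra); nra. }
    intros y y' Qy Qy'; rewrite !Hin1 by assumption; reflexivity.
Qed.

(** * From local to global *)

(** [H] is run in the time window from [s] to [s'], while [G] keeps its parametrization before [s].
    Without any rescaling of earlier times, successive stages differ only by the displacement of the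
    new piece, which is what uniform convergence needs. *)
Lemma append_homotopy (A M : MetricSpace) (G H : A -> unit_int -> M) (s s' : R) :
  continuous (prod_space A unit_space) M (fun q => G (fst q) (snd q)) ->
  continuous (prod_space A unit_space) M (fun q => H (fst q) (snd q)) ->
  (forall x (t : unit_int), s <= proj1_sig t -> G x t = H x (to_unit 0)) -> s < s' ->
  exists G' : A -> unit_int -> M,
    continuous (prod_space A unit_space) M (fun q => G' (fst q) (snd q)) /\
    (forall x (t : unit_int), proj1_sig t <= s -> G' x t = G x t) /\
    (forall x (t : unit_int), s' <= proj1_sig t -> G' x t = H x (to_unit 1)) /\
    (forall x (t : unit_int), s <= proj1_sig t -> exists t', G' x t = H x t').
Proof.
  intros HG HH Hend Hss.
  assert (Hinv : 0 < / (s' - s)) by (apply Rinv_0_lt_compat; lra).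
  exists (fun x t => if Rle_dec (proj1_sig t - s) 0 then G x t
                     else H x (to_unit ((proj1_sig t - s) / (s' - s)))).
  split; [|split; [|split]].
  - apply (continuous_glue (prod_space A unit_space) M (fun q => proj1_sig (snd q) - s)
      (fun q => G (fst q) (snd q))
      (fun q => H (fst q) (to_unit ((proj1_sig (snd q) - s) / (s' - s))))).
    + apply (continuous_lipschitz _ _ _ 1); intros [x t] [y t']; rewrite Rmult_1_l.
      eapply Rle_trans; [|apply Rmax_r]; simpl.
      right; f_equal; ring.
    + exact HG.
    + apply (continuous_comp _ (prod_space A unit_space) M
        (fun q : prod_space A unit_space =>
           (fst q, to_unit ((proj1_sig (snd q) - s) / (s' - s))))
        (fun q => H (fst q) (snd q))); [|exact HH].
      apply (continuous_pair (prod_space A unit_space) A unit_space fst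
        (fun q : prod_space A unit_space => to_unit ((proj1_sig (snd q) - s) / (s' - s))));
        [apply continuous_fst|].
      apply (continuous_comp _ real_space unit_space
        (fun q : prod_space A unit_space => (proj1_sig (snd q) - s) / (s' - s)) to_unit);
        [|apply continuous_to_unit].
      apply (continuous_lipschitz _ _ _ (/ (s' - s))); intros [x t] [y t']; simpl.
      replace (_ - _) with (/ (s' - s) * (proj1_sig t - proj1_sig t')) by (field; lra).
      rewrite Rabs_mult, (Rabs_right (/ (s' - s))) by lra.
      apply Rmult_le_compat_l; [lra | apply Rmax_r].
    + intros [x t] Ht; simpl in *; rewrite Ht; rewrite Hend by lra.
      do 2 f_equal; field; lra.
  - intros x t Ht; destruct Rle_dec; [reflexivity | lra].
  - intros x t Ht; destruct Rle_dec; [lra|]; f_equal.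
    apply sig_eq; simpl; rewrite !clamp_big; [reflexivity | lra |].
    assert ((proj1_sig t - s) / (s' - s) * (s' - s) = proj1_sig t - s) by (field; lra); nra.
  - intros x t Ht; destruct Rle_dec.
    + exists (to_unit 0); now apply Hend.
    + eauto.
Qed.

(** A successor is chosen once for every pair of index and state, with [s0] as a dummy where the
    invariant fails; along the sequence it never fails. *)
Lemma invariant_dependent_choice (S : Type) (P : nat -> S -> Prop)
    (T : nat -> S -> S -> Prop) (s0 : S) :
  P 0%nat s0 -> (forall n s, P n s -> exists s', P (Datatypes.S n) s' /\ T n s s') ->
  exists u : nat -> S, u 0%nat = s0 /\
    forall n, P n (u n) /\ T n (u n) (u (Datatypes.S n)).
Proof.
  intros H0 Hstep.
  destruct (choice (fun (q : nat * S) s' => P (fst q) (snd q) ->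
      P (Datatypes.S (fst q)) s' /\ T (fst q) (snd q) s')) as [next Hnext].
  { intros [n s]; simpl; destruct (classic (P n s)) as [H|H].
    - destruct (Hstep n s H) as [s' Hs']; exists s'; auto.
    - exists s0; tauto. }
  set (u := fix u n := match n with O => s0 | Datatypes.S n => next (n, u n) end).
  assert (Hu : forall n, P n (u n)).
  { induction n as [|n IH]; [exact H0 | exact (proj1 (Hnext (n, u n) IH))]. }
  exists u; split; [reflexivity|]; intro n; split; [apply Hu|].
  exact (proj2 (Hnext (n, u n) (Hu n))).
Qed.

Lemma half_pow_pos (n : nat) : 0 < (1 / 2) ^ n.
Proof. apply pow_lt; lra. Qed.

Lemma half_pow_small (e : R) : e > 0 -> exists N, forall n, (n >= N)%nat -> (1 / 2) ^ n < e.
Proof.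
  intro He; destruct (pow_lt_1_zero (1 / 2)) with (y := e) as [N HN]; [|exact He|].
  - rewrite Rabs_right; lra.
  - exists N; intros n Hn; eapply Rle_lt_trans; [apply Rle_abs | now apply HN].
Qed.

(** Arbitrarily late visits to each box; each one supplies a finer scale. *)
Lemma cyclic_enumeration (T : Type) (l : list T) (d : T) (K : nat) (a : T) :
  In a l -> exists n, (n >= K)%nat /\ nth (n mod length l) l d = a.
Proof.
  intro Ha; destruct (In_nth l a d Ha) as [j [Hj Hnth]].
  exists (j + K * length l)%nat; split; [nia|].
  now rewrite Nat.Div0.mod_add, Nat.mod_small.
Qed.

(** A budget account: the displacement already spent plus the remaining allowance [snd st] stays
    within [b0]. As the allowance is positive, the homotopy is strictly within [b0] of [g], so the
    current map still sends each box into its good neighbourhood. Being stationary from time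
    [1 - (1 / 2) ^ n] on leaves room for the next piece. *)
Definition homotopy_invariant (A M : MetricSpace) (g : A -> M) (b0 : R) (n : nat)
    (st : (A -> unit_int -> M) * R) : Prop :=
  continuous (prod_space A unit_space) M (fun q => fst st (fst q) (snd q)) /\
  (forall x, fst st x (to_unit 0) = g x) /\
  (forall x (t : unit_int), 1 - (1 / 2) ^ n <= proj1_sig t ->
     fst st x t = fst st x (to_unit 1)) /\
  snd st > 0 /\
  (forall x t, dist (g x) (fst st x t) + snd st <= b0).

(* [snd st] bounds every later displacement of the homotopy [fst st]; the new bound
   is chosen so small that the fine cover found at step [n] survives in the limit. *)
Definition homotopy_step (m k : nat) (M : MetricSpace) (rho : R)
    (p : nat -> cube m * cube k) (n : nat)
    (st st' : (cube m * cube k -> unit_int -> M) * R) : Prop :=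
  snd st' <= snd st / 2 /\
  (forall x t, dist (fst st x t) (fst st' x t) <= snd st / 2) /\
  2 * snd st' <= (1 / 2) ^ n /\
  exists c, 4 * snd st' <= c /\
    forall z, dist (m := cube_space m) z (fst (p n)) <= rho ->
      fine_cover (cube k) M (fun y => fst st' (z, y) (to_unit 1))
        (fun y => dist (m := cube_space k) y (snd (p n)) <= rho) k ((1 / 2) ^ n) c.

Lemma homotopy_step_exists (m k : nat) (M : MetricSpace) (g : cube m * cube k -> M)
    (rho b0 : R) (p : nat -> cube m * cube k) (n : nat)
    (st : (cube m * cube k -> unit_int -> M) * R) :
  rho > 0 ->
  (forall a, exists U : M -> Prop, FAP k (subspace M U) /\
     forall x q, dist (m := fibred_cube m k) x a <= 2 * rho -> dist (g x) q < b0 -> U q) ->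
  homotopy_invariant (fibred_cube m k) M g b0 n st ->
  exists st', homotopy_invariant (fibred_cube m k) M g b0 (S n) st' /\
    homotopy_step m k M rho p n st st'.
Proof.
  destruct st as [G b]; intros Hrho HU [HG [HG0 [HGend [Hb Hbound]]]].
  simpl fst in *; simpl snd in *.
  destruct (HU (p n)) as [U [HFAP HUp]].
  destruct (perturb_on_box M m k U (fun x => G x (to_unit 1)) (p n) rho (b / 2) ((1 / 2) ^ n))
    as [H [HH [HH0 [Hclose [c [Hc Hfine]]]]]]; auto.
  - apply (continuous_comp _ (prod_space (fibred_cube m k) unit_space) M
      (fun x => (x, to_unit 1)) (fun q => G (fst q) (snd q))); [|exact HG].
    apply (continuous_lipschitz _ _ _ 1); intros x y; rewrite Rmult_1_l.
    apply Rmax_lub; [apply Rle_refl|].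
    rewrite dist_refl; apply dist_nonneg.
  - intros x Hx; apply (HUp x); [exact Hx|].
    specialize (Hbound x (to_unit 1)); lra.
  - lra.
  - apply half_pow_pos.
  - destruct (append_homotopy (fibred_cube m k) M G H (1 - (1 / 2) ^ n) (1 - (1 / 2) ^ S n))
      as [G' [HG' [Hbefore [Hafter Hmid]]]]; auto.
    + intros x t Ht; rewrite HH0; now apply HGend.
    + pose proof (half_pow_pos n); simpl; lra.
    + assert (HGG : forall x t, dist (G x t) (G' x t) <= b / 2).
      { intros x t; destruct (Rle_dec (1 - (1 / 2) ^ n) (proj1_sig t)) as [Ht|Ht].
        - destruct (Hmid x t Ht) as [t' ->]; rewrite (HGend x t Ht).
          apply Rlt_le, Hclose.
        - rewrite Hbefore, dist_refl; lra. }
      assert (HG1 : forall x, G' x (to_unit 1) = H x (to_unit 1)).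
      { intro x; apply Hafter; rewrite to_unit_id by lra.
        pose proof (half_pow_pos (S n)); lra. }
      (* Half of [b] is spent now and the other half bounds the future. The remaining terms let the
         new cover survive displacement by [b']: its mesh at most doubles, and half of its Lebesgue
         number remains. *)
      set (b' := Rmin (b / 2) (Rmin ((1 / 2) ^ n / 2) (c / 4))).
      assert (Hb1 : b' <= b / 2) by apply Rmin_l.
      assert (Hb2 : b' <= (1 / 2) ^ n / 2)
        by (eapply Rle_trans; [apply Rmin_r | apply Rmin_l]).
      assert (Hb3 : b' <= c / 4)
        by (eapply Rle_trans; [apply Rmin_r | apply Rmin_r]).
      assert (Hb' : b' > 0)
        by (pose proof (half_pow_pos n); repeat apply Rmin_glb_lt; lra).
      exists (G', b'); split.
      * split; [exact HG'|]; simpl fst; simpl snd; split; [|split; [|split]].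
        -- intro x; rewrite Hbefore; [apply HG0|].
           rewrite to_unit_id by lra.
           pose proof (pow_incr (1 / 2) 1 n ltac:(lra)); rewrite pow1 in *; lra.
        -- intros x t Ht; rewrite (HG1 x); now apply Hafter.
        -- exact Hb'.
        -- intros x t; pose proof (HGG x t); specialize (Hbound x t).
           pose proof (dist_tri M (g x) (G x t) (G' x t)); lra.
      * split; [exact Hb1|]; simpl fst; simpl snd; split; [exact HGG|].
        split; [lra|]; exists c; split; [lra|].
        intros z Hz.
        apply (fine_cover_precomp _ _ _ _ _ _ (fun y => y) _ _ _ _ _ (Hfine z Hz)); [auto|].
        intros y y' _ _; now rewrite !HG1.
Qed.

(** Half of [b n] pays for step [n], and the other half dominates [b (S n)], which pays for
    everything later. *)
Lemma shrinking_steps_converge (T : Type) (M : MetricSpace) (u : nat -> T -> M) (b : nat -> R) :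
  complete M -> (forall n, b n > 0) -> (forall n, b (S n) <= b n / 2) ->
  (forall n x, dist (u n x) (u (S n) x) <= b n / 2) ->
  (forall e, e > 0 -> exists n, b n < e) /\
  exists f : T -> M, forall n x, dist (u n x) (f x) <= b n.
Proof.
  intros HM Hpos Hb Hu.
  assert (Hgeo : forall n, b n <= b 0%nat * (1 / 2) ^ n).
  { induction n as [|n IH]; simpl; [lra|]; specialize (Hb n); lra. }
  assert (Hsmall : forall e, e > 0 -> exists n, b n < e).
  { intros e He; pose proof (Hpos 0%nat).
    destruct (half_pow_small (e / b 0%nat)) as [N HN]; [now apply Rdiv_lt_0_compat|].
    exists N; eapply Rle_lt_trans; [apply Hgeo|].
    specialize (HN N (le_n N)).
    apply (Rmult_lt_compat_l (b 0%nat)) in HN; [|lra].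
    replace (b 0%nat * (e / b 0%nat)) with e in HN by (field; lra); exact HN. }
  split; [exact Hsmall|].
  (* Keeping the unspent allowance on the left makes the induction telescope. *)
  assert (Htail : forall n q x, dist (u n x) (u (q + n)%nat x) + b (q + n)%nat <= b n).
  { intros n q x; induction q as [|q IH]; simpl; [rewrite dist_refl; lra|].
    specialize (Hu (q + n)%nat x); specialize (Hb (q + n)%nat).
    pose proof (dist_tri M (u n x) (u (q + n)%nat x) (u (S (q + n)) x)); lra. }
  assert (Hdist : forall n q x, (q >= n)%nat -> dist (u n x) (u q x) < b n).
  { intros n q x Hq; specialize (Htail n (q - n)%nat x).
    replace (q - n + n)%nat with q in Htail by lia; specialize (Hpos q); lra. }
  destruct (choice (fun x l => forall e, e > 0 -> exists N, forall q, (q >= N)%nat ->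
    dist (u q x) l < e)) as [f Hf].
  { intro x; apply (HM (fun n => u n x)); intros e He.
    destruct (Hsmall (e / 2)) as [N HN]; [lra|]; exists N; intros q q' Hq Hq'.
    pose proof (Hdist N q x Hq); pose proof (Hdist N q' x Hq').
    pose proof (dist_tri M (u q x) (u N x) (u q' x)).
    rewrite (dist_sym M (u q x) (u N x)) in *; lra. }
  exists f; intros n x; apply Rle_plus_epsilon; intros e He.
  destruct (Hf x e He) as [N HN].
  specialize (HN (N + n)%nat ltac:(lia)); pose proof (Hdist n (N + n)%nat x ltac:(lia)).
  pose proof (dist_tri M (u n x) (u (N + n)%nat x) (f x)); lra.
Qed.

Lemma FAP_of_local (k : nat) (M : MetricSpace) :
  complete M ->
  (forall z : M, exists U : M -> Prop, is_neighborhood M z U /\ FAP k (subspace M U)) ->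
  FAP k M.
Proof.
  intros HM Hloc eps m g He Hg; apply cont_map_continuous in Hg.
  set (X := fibred_cube m k).
  assert (HX : compact_space X) by (apply compact_prod; apply compact_cube).
  (* One radius [c0] for all of the compact image of [g]: each [c0]-ball centred there lies in a set
     with FAP. *)
  destruct (compact_uniform X (fun x c => exists U : M -> Prop, FAP k (subspace M U) /\
    forall q, dist (g x) q < c -> U q) HX) as [c0 [Hc0 HU]].
  { intros x d d' Hd [U [HF H]]; exists U; split; [exact HF|].
    intros q Hq; apply H; lra. }
  { intro x; destruct (Hloc (g x)) as [U [[r [Hr HrU]] HF]].
    destruct (Hg x (r / 2)) as [d [Hd Hgd]]; [lra|].
    exists (Rmin d (r / 2)); split; [apply Rmin_glb_lt; lra|].
    intros y Hy; exists U; split; [exact HF|]; intros q Hq; apply HrU.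
    specialize (Hgd y (Rlt_le_trans _ _ _ Hy (Rmin_l _ _))).
    pose proof (Rmin_r d (r / 2)); pose proof (dist_tri M (g x) (g y) q); lra. }
  destruct (uniform_continuity X M g (c0 / 2) HX Hg) as [d [Hd Hgd]]; [lra|].
  (* Now [2 * rho < d], so on a box [g] varies by less than [c0 / 2] from its value at the centre;
     the other [c0 / 2] is left for the drift [b0]. The bound [eps / 4] below gives tracks of
     diameter at most [2 * b0], hence at most [eps / 2]. *)
  set (rho := d / 3); assert (Hrho : rho > 0) by (unfold rho; lra).
  set (b0 := Rmin (c0 / 2) (eps / 4)).
  assert (Hb0 : b0 > 0) by (apply Rmin_glb_lt; lra).
  assert (Hb0c : b0 <= c0 / 2) by apply Rmin_l.
  assert (Hb0e : b0 <= eps / 4) by apply Rmin_r.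
  destruct (HX (fun _ => rho)) as [L HL]; [auto|].
  set (p := fun n => nth (n mod length L) L
              (to_cube m (fun _ => 0), to_cube k (fun _ => 0))).
  destruct (invariant_dependent_choice ((cube m * cube k -> unit_int -> M) * R)
    (homotopy_invariant X M g b0) (homotopy_step m k M rho p) (fun x _ => g x, b0)) as [u [Hu0 Hu]].
  { split; [|split; [|split; [|split]]]; simpl; auto.
    - exact (continuous_comp _ _ _ _ _ (continuous_fst _ _) Hg).
    - intros x _; rewrite dist_refl; lra. }
  { intros n st Hst; apply homotopy_step_exists; [exact Hrho | | exact Hst].
    intro a; destruct (HU a) as [U [HF H]]; exists U; split; [exact HF|].
    intros x q Hx Hq; apply H.
    assert (Hxa : dist (g x) (g a) < c0 / 2).
    { apply Hgd, (Rle_lt_trans _ (2 * rho)); [exact Hx | unfold rho; lra]. }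
    pose proof (dist_tri M (g a) (g x) q).
    rewrite (dist_sym M (g a) (g x)) in *; lra. }
  destruct (shrinking_steps_converge (cube m * cube k * unit_int) M
    (fun n q => fst (u n) (fst q) (snd q)) (fun n => snd (u n)) HM)
    as [Hsmall [h Hh]].
  { intro n; apply (proj1 (Hu n)). }
  { intro n; apply (proj2 (Hu n)). }
  { intros n q; apply (proj2 (Hu n)). }
  assert (Hhcont : continuous (prod_space X unit_space) M h).
  { apply (continuous_uniform_limit (prod_space X unit_space) M (fun n q => fst (u n) (fst q) (snd q))).
    - intro n; apply (proj1 (Hu n)).
    - intros e He'; destruct (Hsmall e He') as [n Hn]; exists n; intro x.
      eapply Rle_lt_trans; [apply (Hh n) | exact Hn]. }
  assert (Hh1 : continuous X M (fun x => h (x, to_unit 1))).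
  { apply (continuous_comp _ (prod_space X unit_space) M (fun x => (x, to_unit 1)) h);
      [|exact Hhcont].
    apply (continuous_lipschitz _ _ _ 1); intros x y; rewrite Rmult_1_l.
    apply Rmax_lub; [apply Rle_refl|].
    rewrite dist_refl; apply dist_nonneg. }
  assert (Hclose : forall x t, dist (g x) (h (x, t)) <= b0).
  { intros x t; specialize (Hh 0%nat (x, t)); rewrite Hu0 in Hh; exact Hh. }
  exists (fun x => h (x, to_unit 1)); split; [|split].
  - now apply cont_map_continuous.
  - exists (fun x t => h (x, t)); split; [|split; [|split]].
    + apply cont_htpy_continuous.
      intros [x t] e He'; destruct (Hhcont (x, t) e He') as [r [Hr H]].
      exists r; split; [exact Hr|]; intros [y s]; exact (H (y, s)).
    + intros x t Ht; symmetry; apply dist_eq0, Rle_antisym; [|apply dist_nonneg].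
      apply Rle_plus_epsilon; intros e He'.
      destruct (Hsmall e He') as [n Hn]; specialize (Hh n (x, t)); simpl in Hh.
      assert (E : t = to_unit 0) by (apply sig_eq; rewrite to_unit_id; lra).
      rewrite E in Hh |- *.
      rewrite (proj1 (proj2 (proj1 (Hu n)))) in Hh.
      rewrite Rplus_0_l; exact (Rle_trans _ _ _ Hh (Rlt_le _ _ Hn)).
    + intros x t Ht; do 2 f_equal; apply sig_eq; rewrite to_unit_id; lra.
    + intro x; exists (eps / 2); split; [lra|]; intros s t.
      pose proof (Hclose x s); pose proof (Hclose x t).
      pose proof (dist_tri M (h (x, s)) (g x) (h (x, t))).
      rewrite (dist_sym M (h (x, s)) (g x)) in *; lra.
  - intro z.
    (* Only boxes whose shadow in the parameter cube contains [z] give information on this fibre.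
       They suffice, since the boxes cover every point [(z, y)]. *)
    apply (fine_cover_covering_dim (cube_space k) M (fun y => h ((z, y), to_unit 1)) k
      (map (fun a y => dist (m := cube_space k) y (snd a) <= rho)
        (filter (fun a => if Rle_dec (dist (m := cube_space m) z (fst a)) rho
                          then true else false) L))).
    + apply compact_cube.
    + apply (continuous_comp _ X M (fun y => (z, y)) (fun x => h (x, to_unit 1)));
        [|exact Hh1].
      apply (continuous_lipschitz _ _ _ 1); intros y y'; rewrite Rmult_1_l.
      apply Rmax_lub; [|apply Rle_refl].
      rewrite dist_refl; apply dist_nonneg.
    + intro y; destruct (HL (z, y)) as [a [Ha Hay]].
      rewrite dist_sym in Hay.
      exists (fun y => dist (m := cube_space k) y (snd a) <= rho); split.
      * apply (in_map (fun a y => dist (m := cube_space k) y (snd a) <= rho)).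
        apply filter_In; split; [exact Ha|].
        destruct Rle_dec as [_|n]; [reflexivity|]; exfalso; apply n.
        apply Rlt_le; exact (Rle_lt_trans _ _ _ (Rmax_l _ _) Hay).
      * apply Rlt_le; exact (Rle_lt_trans _ _ _ (Rmax_r _ _) Hay).
    + intros Q HQ e He'; apply in_map_iff in HQ as [a [<- Ha]].
      apply filter_In in Ha as [Ha Hza].
      destruct Rle_dec as [Hz|]; [clear Hza | discriminate].
      (* At a visit [n] beyond [K] the cover has mesh below [e / 2], and passing to the limit adds
         at most [2 * snd (u (S n))], which is also below [e / 2]. *)
      destruct (half_pow_small (e / 2)) as [K HK]; [lra|].
      destruct (cyclic_enumeration _ L (to_cube m (fun _ => 0), to_cube k (fun _ => 0)) K a Ha)
        as [n [Hn Hpn]].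
      change (p n = a) in Hpn.
      destruct (proj2 (Hu n)) as [_ [_ [Hbn [c [Hc Hfine]]]]].
      assert (Hbpos : snd (u (S n)) > 0) by apply (proj1 (Hu (S n))).
      rewrite Hpn in Hfine; specialize (HK n Hn).
      exists (c / 2); split; [lra|].
      apply (fine_cover_perturb _ _ _ _ _ _ _ _ _ _ (snd (u (S n))) (Hfine z Hz)); [|lra|lra].
      intros y _; exact (Hh (S n) ((z, y), to_unit 1)).
Qed.

(** For the forward direction the whole space serves as neighbourhood. The full subspace is a subset
    type, isometric but not equal to [M], so maps, homotopies and covers have to be transported
    along [inc] and its inverse. *)
Lemma FAP_full_subspace (k : nat) (M : MetricSpace) :
  FAP k M -> FAP k (subspace M (fun _ => True)).
Proof.
  intros HM eps m g He Hg.
  destruct (HM eps m (fun x => proj1_sig (g x)) He Hg)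
    as [g' [Hg' [[h [Hh [Hh0 [Hh1 Hsmall]]]] Hdim]]].
  set (inc := fun q => exist (fun _ : M => True) q I).
  exists (fun x => inc (g' x)); split; [exact Hg'|]; split.
  - exists (fun x t => inc (h x t)); split; [exact Hh|]; split; [|split].
    + intros x t Ht; apply sig_eq; exact (Hh0 x t Ht).
    + intros x t Ht; apply sig_eq; exact (Hh1 x t Ht).
    + exact Hsmall.
  - intros z Us Hopen Hcov.
    destruct (Hdim z (map (fun U q => U (inc q)) Us)) as [Vs [HVo [HVc [HVr HVord]]]].
    + intros U HU; apply in_map_iff in HU as [U' [<- HU']].
      intros q [y <-] Uq.
      destruct (Hopen U' HU' (inc (g' (z, y)))) as [r [Hr H]]; [now exists y | exact Uq |].
      exists r; split; [exact Hr|]; intros q' [y' <-] Hq'; apply H; [now exists y' | exact Hq'].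
    + intros q [y <-]; destruct (Hcov (inc (g' (z, y)))) as [U [HU Uq]]; [now exists y|].
      exists (fun q => U (inc q)); split; [|exact Uq].
      now apply (in_map (fun U q => U (inc q))).
    + exists (map (fun V q => V (proj1_sig q)) Vs); split; [|split; [|split]].
      * intros V HV; apply in_map_iff in HV as [V' [<- HV']].
        intros q [y <-] Vq.
        destruct (HVo V' HV' (g' (z, y))) as [r [Hr H]]; [now exists y | exact Vq |].
        exists r; split; [exact Hr|]; intros q' [y' <-] Hq'; apply H; [now exists y' | exact Hq'].
      * intros q [y <-]; destruct (HVc (g' (z, y))) as [V [HV Vq]]; [now exists y|].
        exists (fun q => V (proj1_sig q)); split; [|exact Vq].
        now apply (in_map (fun V (q : subspace M (fun _ => True)) => V (proj1_sig q))).
      * intros V HV; apply in_map_iff in HV as [V' [<- HV']].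
        destruct (HVr V' HV') as [U [HU HVU]]; apply in_map_iff in HU as [U' [<- HU']].
        exists U'; split; [exact HU'|]; intros q [y <-] Vq.
        apply (HVU (g' (z, y))); [now exists y | exact Vq].
      * intros q [y <-] l Hl H; apply (HVord (g' (z, y))); [now exists y | exact Hl |].
        intros i Hi; specialize (H i Hi); rewrite length_map in H.
        (* The pullback of the default set [fun _ => False] is convertible to the default that
           occurs in [H]. *)
        rewrite (map_nth (fun V (q : subspace M (fun _ => True)) => V (proj1_sig q)) Vs
                   (fun _ => False)) in H.
        exact H.
Qed.

Theorem theorem4p3 (n : nat) (M : MetricSpace) (HM : complete M) :
  strong_FAP n M <->
  forall z : M, exists U : M -> Prop,
    is_neighborhood M z U /\ strong_FAP n (subspace M U).
Proof.
  split.
  - intros H z; exists (fun _ => True); split.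
    + exists 1; split; [lra | auto].
    + intros k Hk; now apply FAP_full_subspace, H.
  - intros H k Hk; apply FAP_of_local; [exact HM|]; intro z.
    destruct (H z) as [U [HU HF]]; exists U; auto.
Qed.
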